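(* If $(G_i,\pi^j_i)_I$ is a surjective inverse system of topological groups with $G_i\in\mathsf{TMD}$ for each $i\in I$, then $G:=\varprojlim_i G_i\in\mathsf{TMD}$.
   Context: All topological spaces (and topological groups) are Hausdorff and regular. An inverse system of topological groups $(G_i,\pi^j_i)_I$ consists of a directed set $I$, topological groups $G_i$ ($i\in I$), and continuous homomorphisms $\pi^j_i\colon G_j\to G_i$ for $i\le j$ in $I$ (compatible in the usual sense). Its inverse limit is the topological group $\varprojlim_i G_i=\{(g_i)_{i\in I}\in\prod_{i\in I}G_i:\ \pi^j_i(g_j)=g_i\text{ for all }i\le j\}$ with the subspace topology. The system is surjective if for each $j\in I$ the projection $\pi_j\colon\varprojlim_iG_i\to G_j$ is onto. For a topological group $G$, a $G$-flow is a compact space with a continuous left $G$-action $G\times X\to X$; it is minimal if every orbit is dense. The universal minimal flow $\mathrm{M}(G)$ is the (unique up to isomorphism) minimal $G$-flow which admits a continuous $G$-equivariant map onto every minimal $G$-flow. For a symmetric open neighborhood $U$ of $e_G$ and a $G$-flow $X$, a nonempty open $A\subseteq X$ is $U$-TT if $A\subseteq\overline{UB}$ for every nonempty open $B\subseteq A$. $G\in\mathsf{TMD}$ ($G$ has tractable minimal dynamics) if for every symmetric open neighborhood $U$ of $e_G$, every nonempty open $A\subseteq\mathrm{M}(G)$ contains a nonempty open $U$-TT set. *)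

(* Defs.v *)
From HB Require Import structures.
From mathcomp Require Import all_boot all_order.
From mathcomp Require Import all_classical.
From mathcomp Require Import topology.

Set Implicit Arguments.
Unset Strict Implicit.
Unset Printing Implicit Defensive.

Local Open Scope classical_set_scope.
Local Open Scope group_scope.

(* Hausdorffness is part of the notion of topological group. Regularity, for
   topological groups as for the compact spaces below, then follows. *)
HB.mixin Record isTopologicalGroup G of Topological G & Group G := {
  mulg_continuous : continuous (fun x : G * G => x.1 * x.2);
  invg_continuous : continuous (fun x : G => x^-1);
  topgroup_hausdorff : hausdorff_space G
}.

#[short(type="topologicalGroupType")]
HB.structure Definition TopologicalGroup :=
  {G of isTopologicalGroup G & Topological G & Group G}.

Section Product.
Context {I : choiceType} (G : I -> topologicalGroupType).
Local Notation P := (prod_topology G).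
Implicit Types f g h : P.

Let one : P := fun=> 1.
Let inv f : P := fun i => (f i)^-1.
Let mul f g : P := fun i => f i * g i.

Let mulA : associative mul.
Proof. by move=> f g h; apply: functional_extensionality_dep => i; exact: mulgA. Qed.
Let mul1 : left_id one mul.
Proof. by move=> f; apply: functional_extensionality_dep => i; exact: mul1g. Qed.
Let mulr1 : right_id one mul.
Proof. by move=> f; apply: functional_extensionality_dep => i; exact: mulg1. Qed.
Let mulV : left_inverse one inv mul.
Proof. by move=> f; apply: functional_extensionality_dep => i; exact: mulVg. Qed.
Let mulrV : right_inverse one inv mul.
Proof. by move=> f; apply: functional_extensionality_dep => i; exact: mulgV. Qed.

HB.instance Definition _ := isGroup.Build P mulA mul1 mulr1 mulV mulrV.

Lemma cvg_prodP (F : set_system P) (f : P) : Filter F ->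
  (forall i, (fun g : P => g i) @ F --> f i) -> F --> f.
Proof.
move=> FF Fi; apply/cvg_sup => i A [_ [[B oB <-] Bfi] sBA].
by apply: filterS sBA _; apply: (Fi i); exact: open_nbhs_nbhs.
Qed.

Lemma prod_coord_continuous i : continuous (fun f : P => f i).
Proof. exact: (@proj_continuous I G i). Qed.

Let mul_cont : continuous (fun x : P * P => x.1 * x.2).
Proof.
move=> x; apply: cvg_prodP => i.
apply: (@continuous_comp _ _ _ (fun x : P * P => (x.1 i, x.2 i))
  (fun y : G i * G i => y.1 * y.2)); last exact: mulg_continuous.
apply: cvg_pair.
  exact: continuous_comp cvg_fst (@prod_coord_continuous i _).
exact: continuous_comp cvg_snd (@prod_coord_continuous i _).
Qed.

Let inv_cont : continuous (fun x : P => x^-1).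
Proof.
move=> x; have FF : Filter (nbhs (x : P)) := nbhs_filter x.
apply: cvg_prodP => i.
apply: (@continuous_comp _ _ _ (fun x : P => x i) (fun y : G i => y^-1)).
  exact: prod_coord_continuous.
exact: invg_continuous.
Qed.

Let hausd : hausdorff_space P.
Proof. by apply: hausdorff_product => i; exact: topgroup_hausdorff. Qed.

HB.instance Definition _ :=
  isTopologicalGroup.Build P mul_cont inv_cont hausd.

End Product.

Record inverse_system d (I : preorderType d) := InverseSystem {
  obj :> I -> topologicalGroupType;
  bond : forall i j : I, (i <= j)%O -> obj j -> obj i;
  bondM : forall (i j : I) (ij : (i <= j)%O), {morph bond ij : x y / x * y};
  bond_continuous : forall (i j : I) (ij : (i <= j)%O), continuous (bond ij);
  bond_id : forall (i : I) (ii : (i <= i)%O), bond ii =1 id;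
  bond_comp : forall (i j k : I) (ij : (i <= j)%O) (jk : (j <= k)%O)
    (ik : (i <= k)%O), bond ij \o bond jk =1 bond ik
}.

(* The index set may be empty, in which case the limit is trivial. *)
Definition directed d (I : preorderType d) : Prop :=
  forall i j : I, exists k : I, (i <= k)%O /\ (j <= k)%O.

Section Limit.
Context d (I : preorderType d) (S : inverse_system I).
Local Notation P := (prod_topology (obj S)).

Definition compatible : set P :=
  [set g | forall (i j : I) (ij : (i <= j)%O), bond ij (g j) = g i].

(* [set_type] carries the subspace topology. *)
Definition inverse_limit : Type := set_type compatible.

HB.instance Definition _ := Topological.on inverse_limit.
HB.instance Definition _ := SubChoice.on inverse_limit.

Let bond1 (i j : I) (ij : (i <= j)%O) : bond (i0 := S) ij 1 = 1.
Proof. by apply: (@mulgI _ (bond ij 1)); rewrite -bondM !mulg1. Qed.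

Let bondV (i j : I) (ij : (i <= j)%O) : {morph bond (i0 := S) ij : x / x^-1}.
Proof.
move=> x; apply: (@mulgI _ (bond ij x)).
by rewrite -bondM !mulgV bond1.
Qed.

Let compatible_group : group_closed (fun g : P => g \in compatible).
Proof.
split; first by apply/mem_set => i j ij; exact: bond1.
move=> f g /set_mem cf /set_mem cg; apply/mem_set => i j ij.
rewrite -[(f / g) j]/(f j * (g j)^-1) bondM bondV.
by rewrite (cf _ _ ij) (cg _ _ ij).
Qed.

HB.instance Definition _ := SubChoice_isSubGroup.Build
  P (fun g => g \in compatible) inverse_limit compatible_group.

Let val_cont : continuous (val : inverse_limit -> P).
Proof. exact: initial_continuous. Qed.

Let cvg_val (F : set_system inverse_limit) (g : inverse_limit) : Filter F ->
  (val : inverse_limit -> P) @ F --> val g -> F --> g.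
Proof.
move=> FF Fg A [_ [[B oB <-] Bg] sBA].
by apply: filterS sBA _; apply: Fg; exact: open_nbhs_nbhs.
Qed.

Let val_continuous (T : topologicalType) (f : T -> inverse_limit) :
  continuous ((val : inverse_limit -> P) \o f) -> continuous f.
Proof. by move=> cf x; apply: cvg_val; exact: (cf x). Qed.

Let mul_cont : continuous (fun x : inverse_limit * inverse_limit => x.1 * x.2).
Proof.
apply: val_continuous.
rewrite (_ : _ \o _ = (fun y : P * P => y.1 * y.2) \o
  (fun x : inverse_limit * inverse_limit => (val x.1, val x.2) : P * P)).
  move=> x; apply: continuous_comp; last exact: (@mulg_continuous P).
  have v1 : (fun y : inverse_limit * inverse_limit => val y.1 : P) @ x
      --> (val x.1 : P).
    by apply: (@continuous_comp _ inverse_limit P fst val);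
      [exact: cvg_fst | exact: val_cont].
  have v2 : (fun y : inverse_limit * inverse_limit => val y.2 : P) @ x
      --> (val x.2 : P).
    by apply: (@continuous_comp _ inverse_limit P snd val);
      [exact: cvg_snd | exact: val_cont].
  exact: (cvg_pair v1 v2).
by apply/funext.
Qed.

Let inv_cont : continuous (fun x : inverse_limit => x^-1).
Proof.
apply: val_continuous.
rewrite (_ : _ \o _ = (fun y : P => y^-1) \o (val : inverse_limit -> P)).
  by move=> x; apply: continuous_comp;
    [exact: val_cont | exact: invg_continuous].
by apply/funext.
Qed.

Let hausd : hausdorff_space inverse_limit.
Proof.
move=> f g fg; apply: val_inj; apply: (@topgroup_hausdorff P) => A B Af Bg.
have [h [Ah Bh]] := fg _ _ (val_cont Af) (val_cont Bg).
by exists (val h).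
Qed.

HB.instance Definition _ :=
  isTopologicalGroup.Build inverse_limit mul_cont inv_cont hausd.

Definition limit_proj (j : I) (g : inverse_limit) : S j := (val g : P) j.

Definition surjective_system : Prop :=
  forall (j : I) (x : S j), exists g : inverse_limit, limit_proj j g = x.

End Limit.

Record flow (G : topologicalGroupType) := Flow {
  flow_sort :> topologicalType;
  act : G -> flow_sort -> flow_sort;
  act1 : forall x, act 1 x = x;
  actM : forall g h x, act (g * h) x = act g (act h x);
  act_continuous : continuous (fun p : G * flow_sort => act p.1 p.2);
  flow_compact : compact [set: flow_sort];
  flow_hausdorff : hausdorff_space flow_sort
}.

Section Flows.
Context {G : topologicalGroupType}.
Implicit Types X Y : flow G.

(* The empty flow, whose orbits are vacuously dense, is excluded: no flow would
   map onto both it and a nonempty flow. *)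
Definition minimal X : Prop :=
  [set: X] !=set0 /\ forall x : X, dense (range (fun g : G => act g x)).

Definition flow_map X Y (f : X -> Y) : Prop :=
  continuous f /\ forall (g : G) (x : X), f (act g x) = act g (f x).

Definition universal_minimal_flow X : Prop :=
  minimal X /\
  forall Y, minimal Y -> exists f : X -> Y, flow_map f /\ range f = [set: Y].

(* [A] is [U]-TT. *)
Definition topologically_transitive_for X (U : set G) (A : set X) : Prop :=
  [/\ open A, A !=set0 &
    forall B : set X, open B -> B !=set0 -> B `<=` A ->
      A `<=` closure [set act u b | u in U & b in B]].

End Flows.

Definition symmetric_open_nbhs1 (G : topologicalGroupType) (U : set G) : Prop :=
  [/\ open U, U 1 & forall u, U u -> U u^-1].

(* M(G) is determined by [universal_minimal_flow] up to isomorphism of flows,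
   under which the property below is invariant. *)
Definition TMD (G : topologicalGroupType) : Prop :=
  exists M : flow G, universal_minimal_flow M /\
    forall U : set G, symmetric_open_nbhs1 U ->
    forall A : set M, open A -> A !=set0 ->
      exists2 B : set M, B `<=` A & topologically_transitive_for U B.

(* Main.v *)
From HB Require Import structures.
Require Import Defs.
From mathcomp Require Import all_boot all_order.
From mathcomp Require Import all_classical.
From mathcomp Require Import topology.

(** The proof rests on the greatest ambit (Samuel compactification) S(G) of a
    topological group G. Its points are the filters [round p], for p an
    ultrafilter on G, where [round p] is generated by the sets UA with A in p
    and U a neighborhood of 1. It is a compact Hausdorff G-flow, and every
    point x0 of a G-flow X extends to a map of flows S(G) -> X, sending a
    filter to the limit of g x0 along it. Hence any minimal subflow of S(G) is
    a universal minimal flow. The transitivity property that defines TMD passes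
    from M(G) to its factors, that is, to all minimal G-flows.

    A continuous homomorphism f : G -> H induces S(G) -> S(H). If x and y have
    the same image there, then for A in x, B in y and V a neighborhood of 1 in
    H, some u with f u in V carries a point of A into B: the fibers of
    S(G) -> S(H) are controlled by the preimages of neighborhoods of 1
    (lemma [ambit_pushforward_near]).

    Suppose that f is onto and H is TMD. Let X be a minimal G-flow and N a
    minimal subflow of S(G). There are maps r : N -> X and t : N -> Y, where Y
    is the image of N in S(H), a minimal H-flow. Since maps between minimal
    flows send nonempty open sets to sets with nonempty interior, a V-TT set in
    Y can be pulled back along t and pushed along r; by the control of the
    fibers of t, the result is U-TT as soon as U contains the product of the
    preimage of V with itself (lemma [TT_pibase_transfer]).

    Finally, as the index set is directed, each neighborhood of 1 in the limit
    contains the preimage of a neighborhood of 1 in a single G_i (lemma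
    [limit_nbhs1]), and the projection to G_i is onto. So the previous paragraph
    applies with H = G_i, for an index i that depends on U. *)

Set Implicit Arguments.
Unset Strict Implicit.
Unset Printing Implicit Defensive.

Local Open Scope classical_set_scope.
Local Open Scope group_scope.

(** * Ultrafilters, subspaces and neighborhoods in topological groups *)

Lemma cvg_subset_unique (T : topologicalType) (F H : set_system T) (x y : T) :
  hausdorff_space T -> ProperFilter H -> F `<=` H ->
  F --> x -> H --> y -> x = y.
Proof.
move=> hT HH FH Fx Hy; apply: (cvg_unique (F := H) hT) => //.
by move=> A Ax; apply: FH; exact: Fx.
Qed.

Lemma ultra_setVsetC (T : Type) (F : set_system T) : ProperFilter F ->
  (forall A, F A \/ F (~` A)) -> UltraFilter F.
Proof.
move=> FF FU; split=> // H HF FH; apply/seteqP; split=> // A HA.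
have [//|/FH HnA] := FU A.
by have [x []] := filter_ex (filterI HA HnA).
Qed.

Lemma fmap_ultra (T U : Type) (f : T -> U) (F : set_system T) :
  UltraFilter F -> UltraFilter (f @ F).
Proof.
by move=> FU; apply: ultra_setVsetC => A; exact: (in_ultra_setVsetC (f @^-1` A)).
Qed.

Lemma cvg_set_val (T : topologicalType) (C : set T) (F : set_system C) (x : C) :
  Filter F -> (val : C -> T) @ F --> val x -> F --> x.
Proof.
move=> FF Fx A [_ [[B oB <-] Bx] sBA].
by apply: filterS sBA _; apply: Fx; exact: open_nbhs_nbhs.
Qed.

Lemma set_val_continuous (T : topologicalType) (C : set T) :
  continuous (val : C -> T).
Proof. exact: initial_continuous. Qed.

Lemma continuous_set_val (S T : topologicalType) (C : set T) (f : S -> C) :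
  continuous (fun x => val (f x) : T) -> continuous f.
Proof. by move=> cf x; apply: cvg_set_val; exact: cf. Qed.

Lemma set_val_hausdorff (T : topologicalType) (C : set T) :
  hausdorff_space T -> hausdorff_space C.
Proof.
move=> hT x y xy; apply: val_inj; apply: hT => A B Ax By.
have [z [Az Bz]] := xy _ _ (set_val_continuous Ax) (set_val_continuous By).
by exists (val z).
Qed.

Lemma set_val_compact (T : topologicalType) (C : set T) :
  compact [set: T] -> closed C -> compact [set: C].
Proof.
rewrite !compact_ultra => cT cC F FU _; have FF := @ultra_proper _ _ FU.
have [x [_ Fx]] := cT _ (fmap_ultra (val : C -> T) FU) filterT.
have Cx : C x.
  apply: (@closed_cvg _ _ F _ val C) Fx => //.
  by apply: (@filterS _ F) filterT => z _; exact/set_mem/valP.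
by exists (SigSub (mem_set Cx)); split=> //; exact: cvg_set_val.
Qed.

Section GroupNbhs.
Context {G : topologicalGroupType}.
Implicit Types (U V : set G) (g : G).

Lemma nbhs1_square U : nbhs (1 : G) U ->
  exists2 V, symmetric_open_nbhs1 V & forall u v, V u -> V v -> U (u * v).
Proof.
move=> U1; have := @mulg_continuous G (1, 1).
rewrite /continuous_at /= mulg1 => /(_ _ U1) [[A B] /= [A1 B1] AB].
pose W := (A `&` B)°.
have oW : open W by exact: open_interior.
have W1 : W 1 by apply: nbhs_singleton; apply: nbhs_interior; exact: filterI.
exists (W `&` (fun x => x^-1) @^-1` W).
  split; first by apply: openI => //; apply: open_comp => // x _;
    exact: invg_continuous.
    by split=> //=; rewrite invg1.
  by move=> u [Wu /= Wiu]; split=> //=; rewrite invgK.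
move=> u v [/interior_subset [Au _] _] [/interior_subset [_ Bv] _].
exact: (AB (u, v)).
Qed.

Lemma nbhs_mulVg g U : nbhs (1 : G) U -> nbhs g [set h | U (g^-1 * h)].
Proof.
move=> U1; have : {for g, continuous (fun h => g^-1 * h)}.
  apply: (@continuous_comp _ _ _ (fun h => (g^-1, h))
    (fun x : G * G => x.1 * x.2)); last exact: mulg_continuous.
  by apply: cvg_pair; [exact: cvg_cst | exact: cvg_id].
by move/(_ U); rewrite mulVg; exact.
Qed.

Lemma nbhs1_conj g U :
  nbhs (1 : G) U -> nbhs (1 : G) [set u | U (g * u * g^-1)].
Proof.
move=> U1; have : {for 1, continuous (fun u => g * u * g^-1)}.
  apply: (@continuous_comp _ _ _ (fun u => g * u) (fun h => h * g^-1)).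
    apply: (@continuous_comp _ _ _ (fun h => (g, h))
      (fun x : G * G => x.1 * x.2)); last exact: mulg_continuous.
    by apply: cvg_pair; [exact: cvg_cst | exact: cvg_id].
  apply: (@continuous_comp _ _ _ (fun h => (h, g^-1))
    (fun x : G * G => x.1 * x.2)); last exact: mulg_continuous.
  by apply: cvg_pair; [exact: cvg_id | exact: cvg_cst].
by move/(_ U); rewrite mulg1 mulgV; exact.
Qed.

Lemma symmetric_open_nbhs1_nbhs V :
  symmetric_open_nbhs1 V -> nbhs (1 : G) V.
Proof. by case=> oV V1 _; exact: open_nbhs_nbhs. Qed.

End GroupNbhs.

(** * The greatest ambit *)

Section GreatestAmbit.
Context {G : topologicalGroupType}.
Implicit Types (p : set_system G) (U V : set G) (A B : set G).

Definition core U B : set G := [set a | forall u, U u -> B (u * a)].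

(** The filter generated by the sets UA, for A in p and U a neighborhood of 1:
    UA is contained in B exactly when A is contained in [core U B]. *)
Definition round p : set_system G :=
  [set B | exists2 U, nbhs (1 : G) U & p (core U B)].

Lemma round_sub p : Filter p -> round p `<=` p.
Proof.
move=> pF B [U U1 pB]; apply: filterS pB => a /(_ 1).
by rewrite mul1g; apply; exact: nbhs_singleton.
Qed.

Lemma round_filter p : ProperFilter p -> ProperFilter (round p).
Proof.
move=> pF; apply: Build_ProperFilter_ex.
  by move=> B /round_sub; exact: filter_ex.
split.
- by exists setT; [exact: filterT | apply: filterS filterT].
- move=> A B [U U1 pA] [V V1 pB]; exists (U `&` V); first exact: filterI.
  apply: filterS (filterI pA pB) => a [Aa Ba] u [Uu Vu].
  by split; [exact: Aa | exact: Ba].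
- move=> A B AB [U U1 pA]; exists U => //.
  by apply: filterS pA => a Aa u Uu; apply: AB; exact: Aa.
Qed.

(** Rounding is idempotent: if UA is contained in B and VV in U, then V(VA) is
    contained in B, and VA already belongs to [round p]. *)
Lemma round_core p B : Filter p -> round p B ->
  exists2 V, symmetric_open_nbhs1 V & round p (core V B).
Proof.
move=> pF [U /nbhs1_square [V sV VU] pB]; exists V => //.
exists V; first exact: symmetric_open_nbhs1_nbhs.
by apply: filterS pB => a aB v Vv u Vu; rewrite mulgA; apply/aB/VU.
Qed.

(** This is where p and q have to be ultrafilters: if B is not in [round q],
    then q contains the complement of [core W B], whose W-neighborhood misses
    [core V B] once WW is contained in V. *)
Lemma round_separated p q B : UltraFilter p -> UltraFilter q ->
  round p B -> ~ round q B ->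
  exists A C, [/\ round p A, round q C & A `&` C = set0].
Proof.
move=> pU qU pB qB; have [V sV pA] := round_core (ultra_proper (F := p)) pB.
have [W sW WV] := nbhs1_square (symmetric_open_nbhs1_nbhs sV).
have W1 := symmetric_open_nbhs1_nbhs sW.
exists (core V B), [set b | exists2 w, W w & ~ core W B (w^-1 * b)]; split=> //.
- have [qn|qc] := in_ultra_setVsetC (core W B) qU; first by case: qB; exists W.
  by exists W => //; apply: filterS qc => a na w Ww; exists w; rewrite ?mulKg.
- apply/seteqP; split=> // b [bB [w Ww]]; apply=> u Wu.
  by rewrite mulgA; apply/bB/WV => //; case: sW => _ _; exact.
Qed.

(** A point of the quotient of the ultrafilters on G, where p and q are
    identified when [round p = round q]; the common filter is a canonical
    representative of the class. *)
Record greatest_ambit : Type := GreatestAmbit {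
  trace :> set_system G;
  traceP : exists2 p, UltraFilter p & trace = round p
}.

HB.instance Definition _ := gen_eqMixin greatest_ambit.
HB.instance Definition _ := gen_choiceMixin greatest_ambit.

Lemma trace_inj : injective trace.
Proof.
move=> [x xP] [y yP] /= xy; subst y.
by congr GreatestAmbit; exact: Prop_irrelevance.
Qed.

#[global] Instance trace_filter (x : greatest_ambit) : ProperFilter (trace x).
Proof. by have [p pU ->] := traceP x; exact: round_filter. Qed.

Lemma trace_core (x : greatest_ambit) B : trace x B ->
  exists2 V, symmetric_open_nbhs1 V & trace x (core V B).
Proof.
by have [p pU ->] := traceP x; exact: (round_core (@ultra_proper _ _ pU)).
Qed.

Definition basic B : set greatest_ambit := [set x | trace x B].

HB.instance Definition _ := hasNbhs.Build greatest_ambit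
  (fun x => [set N | exists2 B, trace x B & basic B `<=` N]).

Let nbhs_proper (x : greatest_ambit) : ProperFilter (nbhs x).
Proof.
apply: Build_ProperFilter_ex.
  by move=> N [B xB BN]; exists x; exact: BN.
split.
- by exists setT => //; exact: filterT.
- move=> M N [A xA AM] [B xB BN]; exists (A `&` B); first exact: filterI.
  move=> y yAB; split; [apply: AM | apply: BN];
    by apply: filterS yAB => z [].
- by move=> M N MN [B xB BM]; exists B => //; exact: subset_trans MN.
Qed.

Let nbhs_point (x : greatest_ambit) N : nbhs x N -> N x.
Proof. by move=> [B xB]; exact. Qed.

Let nbhs_nbhs_ambit (x : greatest_ambit) N : nbhs x N -> nbhs x (nbhs^~ N).
Proof. by move=> [B xB BN]; exists B => // y yB; exists B. Qed.

HB.instance Definition _ := Nbhs_isNbhsTopological.Build greatest_ambit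
  nbhs_proper nbhs_point nbhs_nbhs_ambit.

Lemma greatest_ambit_hausdorff : hausdorff_space greatest_ambit.
Proof.
suff sub x y : cluster (nbhs x) y -> trace x `<=` trace y.
  move=> x y xy; apply: trace_inj; apply/seteqP; split; first exact: sub.
  by apply: sub => A B Ay Bx; rewrite setIC; exact: xy.
have [p pU xp] := traceP x; have [q qU yq] := traceP y.
move=> xy B; rewrite xp yq => pB; apply: contrapT => qB.
have [A [C [pA qC AC]]] := round_separated pU qU pB qB.
have [||z [zA zC]] := xy (basic A) (basic C).
- by exists A => //; rewrite xp.
- by exists C => //; rewrite yq.
by have [b] := filter_ex (filterI zA zC); rewrite AC.
Qed.

(** An ultrafilter F on the ambit has a limit computed from a choice s of an
    ultrafilter in each class: the sets A that belong to [s x] for F-almost all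
    x form an ultrafilter p on G, and F converges to the class of p. *)
Lemma greatest_ambit_compact : compact [set: greatest_ambit].
Proof.
rewrite compact_ultra => F FU _.
have /boolp.choice [s sP] : forall x : greatest_ambit, exists p,
    UltraFilter p /\ trace x = round p.
  by move=> x; have [p] := traceP x; exists p.
pose p : set_system G := [set A | F [set x | s x A]].
have sU x : UltraFilter (s x) by have [] := sP x.
have pU : UltraFilter p.
  apply: ultra_setVsetC; last first.
    move=> A; have [FA|FnA] := in_ultra_setVsetC [set x | s x A] FU.
      by left.
    right; apply: filterS FnA => x /= nsA.
    by have [|] := in_ultra_setVsetC A (sU x).
  apply: Build_ProperFilter_ex.
    by move=> A /(@filter_ex _ F) [x sA]; exact: (@filter_ex _ (s x)).
  split.
  - by apply: (@filterS _ F) filterT => x _; exact: filterT.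
  - move=> A B pA pB; apply: (@filterS _ F) (@filterI _ F _ _ _ pA pB).
    by move=> x [] /=; exact: filterI.
  - by move=> A B AB; apply: (@filterS _ F) => x /=; exact: filterS.
have roundP : exists2 q, UltraFilter q & round p = round q by exists p.
exists (GreatestAmbit roundP); split=> // N [B [U U1 pB] BN].
apply: filterS BN _; apply: (@filterS _ F) pB => x sB.
by rewrite /basic /=; have [_ ->] := sP x; exists U.
Qed.

(** Left translation does not commute with [core U], but turns it into the core
    for a conjugate of U, which is again a neighborhood of 1. *)
Lemma round_mulg g p : Filter p -> (mul g @ round p) = round (mul g @ p).
Proof.
move=> pF; apply/seteqP; split=> B [U U1 pB].
  exists [set u | U (g^-1 * u * g^-1^-1)]; first exact: nbhs1_conj.
  move: pB; apply: (@filterS _ p) => b bB u /= /bB /=.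
  by rewrite invgK !mulgA mulgV mul1g -mulgA.
exists [set u | U (g * u * g^-1)]; first exact: nbhs1_conj.
move: pB; apply: (@filterS _ p) => b bB u /= /bB /=.
by rewrite -!mulgA mulKg.
Qed.

Lemma ambit_act_subproof g (x : greatest_ambit) :
  exists2 p, UltraFilter p & mul g @ trace x = round p.
Proof.
have [p pU ->] := traceP x; exists (mul g @ p); first exact: fmap_ultra.
exact: round_mulg.
Qed.

Definition ambit_act g x : greatest_ambit :=
  GreatestAmbit (ambit_act_subproof g x).

Let ambit_act1 x : ambit_act 1 x = x.
Proof.
apply: trace_inj; apply/seteqP; split=> B; rewrite /= /nbhs /=;
by apply: filterS => b /=; rewrite mul1g.
Qed.

Let ambit_actM g h x : ambit_act (g * h) x = ambit_act g (ambit_act h x).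
Proof.
apply: trace_inj; apply/seteqP; split=> B; rewrite /= /nbhs /=;
by apply: filterS => b /=; rewrite mulgA.
Qed.

(* Joint continuity needs the idempotence of rounding: a factor V must be left
   to absorb the variation of the group element. *)
Let ambit_act_continuous :
  continuous (fun p : G * greatest_ambit => ambit_act p.1 p.2).
Proof.
move=> [g x] N [B gxB BN].
have [V sV xB] := @trace_core x (mul g @^-1` B) gxB.
exists ([set h | V (g^-1 * h)], basic (core V (mul g @^-1` B))) => /=.
  split; first exact/nbhs_mulVg/symmetric_open_nbhs1_nbhs.
  by exists (core V (mul g @^-1` B)).
move=> [h y] /= [Vh yB]; apply: BN; rewrite /basic /=.
move: yB; apply: (@filterS _ (trace y)) => b /(_ _ Vh) /=.
by rewrite mulgA mulVKg.
Qed.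

Definition ambit_flow : flow G := Flow ambit_act1 ambit_actM
  ambit_act_continuous greatest_ambit_compact greatest_ambit_hausdorff.

End GreatestAmbit.

Definition ambit_base (G : topologicalGroupType) : ambit_flow (G := G) :=
  GreatestAmbit (ex_intro2 _ _ _ (principal_filter_ultra (1 : G)) erefl).

(** * Maps from the greatest ambit to flows *)

Section FlowBasics.
Context {G : topologicalGroupType} (X : flow G).

Lemma act_continuousr g : continuous (act (f := X) g).
Proof.
move=> x; apply: (@continuous_comp _ _ _ (fun x => (g, x))
  (fun p : G * X => act p.1 p.2)); last exact: act_continuous.
by apply: cvg_pair; [exact: cvg_cst | exact: cvg_id].
Qed.

Lemma actK g : cancel (act (f := X) g) (act g^-1).
Proof. by move=> x; rewrite -actM mulVg act1. Qed.

Lemma actVK g : cancel (act (f := X) g^-1) (act g).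
Proof. by move=> x; rewrite -actM mulgV act1. Qed.

Lemma open_act g (W : set X) : open W -> open (act g @^-1` W).
Proof. by move=> oW; apply: open_comp => // x _; exact: act_continuousr. Qed.

Lemma flow_regular (x : X) N : nbhs x N ->
  exists2 M, nbhs x M & closure M `<=` N.
Proof.
move=> xN; have := @compact_regular X x setT (@flow_hausdorff _ X)
  (@flow_compact _ X) filterT.
by move=> /(_ _ N xN) [M ? ?]; exists M.
Qed.

End FlowBasics.

Section AmbitMap.
Context {G : topologicalGroupType} (X : flow G) (x0 : X).
Local Notation orbit_map := (fun g : G => act g x0).

(** The image of an ultrafilter p converges by compactness, to y say. That the
    coarser filter [round p] still has limit y is the joint continuity of the
    action at (1, y). *)
Lemma orbit_cvg (x : greatest_ambit (G := G)) :
  exists y : X, orbit_map @ trace x --> y.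
Proof.
have [p pU ->] := traceP x; have pF := @ultra_proper _ _ pU.
have := flow_compact (f := X); rewrite compact_ultra.
move=> /(_ (orbit_map @ p) (fmap_ultra _ pU) filterT) [y [_ py]]; exists y => N.
rewrite -[y in nbhs y]act1.
move=> /(@act_continuous _ X (1, y)) [[U M] /= [U1 yM] UM].
exists U => //; move: (py _ yM); apply: (@filterS _ p) => g Mg u Uu.
by have := UM (u, act g x0) (conj Uu Mg); rewrite /= actM.
Qed.

Definition ambit_map x : X := sval (cid (orbit_cvg x)).

Lemma ambit_map_cvg x : orbit_map @ trace x --> ambit_map x.
Proof. by rewrite /ambit_map; case: cid. Qed.

Lemma ambit_map_flow_map : flow_map (X := ambit_flow) ambit_map.
Proof.
split=> [x N /flow_regular [M xM MN]|g x].
  exists (orbit_map @^-1` M); first exact: ambit_map_cvg xM.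
  move=> y yM; apply: MN.
  apply: (@closed_cvg _ _ (trace y) _ orbit_map (closure M) _ _ _
    (@ambit_map_cvg y)).
    exact: closed_closure.
  by move: yM; apply: (@filterS _ (trace y)) => h Mh; exact: subset_closure.
apply: (cvg_unique (F := orbit_map @ trace (ambit_act g x))
  (@flow_hausdorff _ X)); first exact: ambit_map_cvg.
have -> : orbit_map @ trace (ambit_act g x) =
    (fun x : X => act g x) @ (orbit_map @ trace x).
  apply/seteqP; split=> B; rewrite /= /nbhs /=;
  by apply: filterS => b /=; rewrite actM.
by apply: cvg_comp; [exact: ambit_map_cvg | exact: act_continuousr].
Qed.

End AmbitMap.

(** * Minimal flows *)

Section Subflow.
Context {G : topologicalGroupType} (X : flow G) (C : set X).
Hypotheses (closedC : closed C) (invC : forall g x, C x -> C (act g x)).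

Let sact (g : G) (x : C) : C := SigSub (mem_set (invC g (set_mem (valP x)))).

Let sact1 x : sact 1 x = x.
Proof. by apply: val_inj; rewrite /= act1. Qed.

Let sactM g h x : sact (g * h) x = sact g (sact h x).
Proof. by apply: val_inj; rewrite /= actM. Qed.

Let sact_continuous : continuous (fun p : G * C => sact p.1 p.2).
Proof.
apply: continuous_set_val => -[g x] /=.
apply: (@continuous_comp _ _ _ (fun p : G * C => (p.1, val p.2 : X))
  (fun p : G * X => act p.1 p.2)); last exact: act_continuous.
apply: cvg_pair; first exact: cvg_fst.
apply: (@continuous_comp _ _ _ snd (val : C -> X)); first exact: cvg_snd.
exact: set_val_continuous.
Qed.

Definition subflow : flow G := Flow sact1 sactM sact_continuous
  (set_val_compact (@flow_compact _ X) closedC)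
  (set_val_hausdorff (C := C) (@flow_hausdorff _ X)).

Lemma subflow_val_flow_map : flow_map (X := subflow) (val : C -> X).
Proof. by split=> //; exact: set_val_continuous. Qed.

End Subflow.

Section RestrictFlow.
Context {G H : topologicalGroupType} (f : G -> H).
Hypotheses (fM : {morph f : x y / x * y}) (fC : continuous f).
Variable Y : flow H.

Let ract (g : G) (y : Y) : Y := act (f g) y.

Let ract1 x : ract 1 x = x.
Proof.
suff f1 : f 1 = 1 by rewrite /ract f1 act1.
by apply: (@mulgI _ (f 1)); rewrite -fM !mulg1.
Qed.

Let ractM g h x : ract (g * h) x = ract g (ract h x).
Proof. by rewrite /ract fM actM. Qed.

Let ract_continuous : continuous (fun p : G * Y => ract p.1 p.2).
Proof.
move=> p; apply: (@continuous_comp _ _ _ (fun p : G * Y => (f p.1, p.2))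
  (fun p : H * Y => act p.1 p.2)); last exact: act_continuous.
apply: cvg_pair; last exact: cvg_snd.
by apply: (@continuous_comp _ _ _ fst f); [exact: cvg_fst | exact: fC].
Qed.

Definition restrict_flow : flow G := Flow ract1 ractM ract_continuous
  (@flow_compact _ Y) (@flow_hausdorff _ Y).

End RestrictFlow.

Section Minimality.
Context {G : topologicalGroupType}.
Implicit Types X Y N : flow G.

Lemma minimalP X : minimal X <-> [set: X] !=set0 /\
  forall (W : set X) x, open W -> W !=set0 -> exists g, W (act g x).
Proof.
split=> -[X0 mX]; split=> //.
  move=> W x oW W0; have [y [Wy [g _ gx]]] := mX x W W0 oW.
  by exists g; rewrite gx.
move=> x W W0 oW; have [g Wg] := mX W x oW W0.
by exists (act g x); split=> //; exists g.
Qed.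

Lemma flow_map_comp X Y N (f : X -> Y) (g : Y -> N) :
  flow_map f -> flow_map g -> flow_map (g \o f).
Proof.
move=> [fc fe] [gc ge]; split=> [x|a x /=]; last by rewrite fe ge.
by apply: continuous_comp; [exact: fc | exact: gc].
Qed.

Lemma range_closed X Y (f : X -> Y) : continuous f -> closed (range f).
Proof.
move=> fc; apply: compact_closed; first exact: flow_hausdorff.
by apply: continuous_compact; [exact: continuous_subspaceT | exact: flow_compact].
Qed.

Lemma flow_map_onto X Y (f : X -> Y) :
  [set: X] !=set0 -> minimal Y -> flow_map f -> range f = [set: Y].
Proof.
move=> [x _] /minimalP [_ mY] [fc fe]; apply/seteqP; split=> // y _.
apply: contrapT => fy.
have [||g] := mY (~` range f) (f x); first exact/closed_openC/range_closed.
  by exists y.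
by apply; exists (act g x).
Qed.

(** Zorn's lemma is applied to the complements, the proper open sets O such
    that the complement of O is invariant: chains then have unions, which are
    proper by compactness. *)
Lemma exists_minimal_flow X : [set: X] !=set0 ->
  exists (N : flow G) (i : N -> X), minimal N /\ flow_map i.
Proof.
move=> X0.
pose P (O : set X) := [/\ open O, forall g x, O (act g x) -> O x & ~` O !=set0].
have [|O [[oO invO O0] maxO]] := @Zorn_bigcup X P.
  move=> K KP totK; split.
  - by apply: bigcup_open => O /KP [].
  - move=> g x [O KO Ogx]; exists O => //.
    by have [_ + _] := KP _ KO; apply; exact: Ogx.
  apply: contrapT => nK0.
  have KT x : exists2 O, K O & O x.
    apply: contrapT => nx; apply: nK0; exists x => -[O ? ?].
    by apply: nx; exists O.
  have [x0 _] := X0; have [O0 KO0 _] := KT x0.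
  (* A cluster point of the complements of the members of the chain would be in
     none of these members. *)
  have FF : ProperFilter (filter_from K setC).
    apply: filter_from_proper; last by move=> O /KP [].
    apply: filter_from_filter; first by exists O0.
    move=> A B KA KB; have [AB|BA] := totK _ _ KA KB.
      by exists B => // x Bx; split=> // /AB.
    by exists A => // x Ax; split=> // /BA.
  have [x [_ xF]] := flow_compact (f := X) FF filterT.
  have [O KO Ox] := KT x.
  have [||y [nOy Oy]] := xF (~` O) O; [by exists O| |by []].
  by apply: open_nbhs_nbhs; split=> //; have [] := KP _ KO.
have invC g x : (~` O) x -> (~` O) (act g x) by move=> nOx /invO.
exists (subflow (open_closedC oO) invC), (val : set_type _ -> X).
split; last exact: subflow_val_flow_map.
apply/minimalP; split.
  by have [x Ox] := O0; exists (SigSub (mem_set Ox)).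
move=> _ x [W oW <-] [y Wy].
have [[g Wgx]|nW] := pselect (exists g, W (act g (val x))); first by exists g.
have nOx : ~ O (val x) by exact: set_mem (valP x).
(* Adding to O all the translates of W would enlarge it, while still omitting
   x. *)
exfalso; apply: (maxO (O `|` \bigcup_(g : G) (act g @^-1` W))).
  split; first by left.
  have nOy : ~ O (val y) by exact: set_mem (valP y).
  move=> /(_ (val y)) h; apply/nOy/h; right.
  by exists 1 => //=; rewrite act1.
split.
- by apply: openU => //; apply: bigcup_open => g _; exact: open_act.
- move=> g z [/invO|[h _ /= Wz]]; first by left.
  by right; exists (h * g) => //=; rewrite actM.
- by exists (val x) => -[//|[g _ Wg]]; apply: nW; exists g.
Qed.

(** Choose M open with closure in A. By minimality the translates of M cover X;
    so finitely many translates of the closed set [f @` closure M] cover Y, and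
    they cannot all be nowhere dense. The finiteness is handled by a cluster
    point of the filter generated by the preimages of dense open sets of Y. *)
Lemma interior_image_nonempty X Y (f : X -> Y) (A : set X) :
  minimal X -> flow_map f -> range f = [set: Y] ->
  open A -> A !=set0 -> (f @` A)° !=set0.
Proof.
move=> /minimalP [[x0 _] mX] [fc fe] fT oA [a Aa].
have [M aM MA] := flow_regular (open_nbhs_nbhs (conj oA Aa)).
apply: contrapT => intA.
pose K := f @` closure M.
have cK : closed K.
  apply: compact_closed; first exact: flow_hausdorff.
  apply: continuous_compact; first exact: continuous_subspaceT.
  exact: (subclosed_compact (@closed_closure _ M) (@flow_compact _ X)).
pose D := [set D : set Y | open D /\ dense D].
have FF : ProperFilter (filter_from D (fun E => f @^-1` E)).
  apply: filter_from_proper.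
    apply: filter_from_filter.
      by exists setT; split; [exact: openT | move=> O O0 _; rewrite setIT].
    move=> E E' [oE dE] [oE' dE']; exists (E `&` E') => //.
    by split; [exact: openI | exact: denseI].
  move=> E [oE dE]; have [|y [_ Ey]] := dE setT _ openT; first by exists (f x0).
  have : range f y by rewrite fT.
  by move=> [x _ fx]; exists x; rewrite /= fx.
have [x [_ xF]] := flow_compact (f := X) FF filterT.
have [g Mgx] := mX _ x (open_interior M) (ex_intro _ a aM).
have [||y [nKy My]] :=
  xF (f @^-1` (act g @^-1` (~` K))) (act g @^-1` M°).
- exists (act g @^-1` (~` K)) => //; split; first exact/open_act/closed_openC.
  move=> O [y Oy] oO; apply: contrapT => OK; apply: intA.
  exists (act g y); apply: (@filterS _ (nbhs (act g y)) _ K).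
    by move=> _ [z Mz <-]; exists z => //; exact: MA.
  apply: (@filterS _ _ _ (act g^-1 @^-1` O)).
    move=> z Oz; apply: contrapT => nKz; apply: OK.
    by exists (act g^-1 z); split=> //=; rewrite actVK.
  by apply: open_nbhs_nbhs; split; [exact: open_act | rewrite /= actK].
- by apply: open_nbhs_nbhs; split=> //; exact/open_act/open_interior.
- apply: nKy; exists (act g y); last by rewrite fe.
  by apply: subset_closure; exact: interior_subset My.
Qed.

End Minimality.

Lemma exists_universal_minimal_flow (G : topologicalGroupType) :
  exists M : flow G, universal_minimal_flow M.
Proof.
have [M [i [mM iF]]] :=
  @exists_minimal_flow G ambit_flow (ex_intro _ (ambit_base G) I).
exists M; split=> // Y mY; have [[y _] _] := mY.
exists (ambit_map y \o i).
have F : flow_map (ambit_map y \o i) := flow_map_comp iF (ambit_map_flow_map y).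
by split=> //; apply: flow_map_onto => //; case: mM.
Qed.

(** * Change of group *)

Section ChangeOfGroup.
Context {G H : topologicalGroupType} (f : G -> H).
Hypotheses (fM : {morph f : x y / x * y}) (fC : continuous f).

Definition ambit_pushforward (x : ambit_flow (G := G)) :
    restrict_flow fM fC (ambit_flow (G := H)) :=
  ambit_map (X := restrict_flow fM fC ambit_flow) (ambit_base H) x.

Lemma ambit_pushforwardE x p : UltraFilter p -> trace x = round p ->
  trace (ambit_pushforward x : ambit_flow) = round (f @ p).
Proof.
move=> pU xp.
pose z := GreatestAmbit (ex_intro2 _ _ _ (fmap_ultra f pU) erefl).
suff -> : ambit_pushforward x = z by [].
have pF := @ultra_proper _ _ pU.
apply: (@cvg_subset_unique _ ((fun g => act (f g) (ambit_base H)) @ trace x)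
  ((fun g => act (f g) (ambit_base H)) @ p)).
- exact: greatest_ambit_hausdorff.
- by rewrite xp => A; exact: round_sub.
- exact: (@ambit_map_cvg _ (restrict_flow fM fC ambit_flow) (ambit_base H) x).
move=> N [B [U U1 pB] BN].
move: pB; apply: (@filterS _ p) => g gB; apply: BN.
exists [set u | U (f g * u * (f g)^-1)]; first exact: nbhs1_conj.
apply/principal_filterP => u /gB /=.
by rewrite mulgVK mulg1.
Qed.

(** With p and q ultrafilters in the classes x and y, the hypothesis says that
    [round (f @ p) = round (f @ q)]. So V f(A), which is in the former, is in
    f @ q and meets f(B). *)
Lemma ambit_pushforward_near x y : ambit_pushforward x = ambit_pushforward y ->
  forall (A B : set G) (V : set H), trace x A -> trace y B ->
  nbhs (1 : H) V -> exists u a, [/\ V (f u), A a & B (u * a)].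
Proof.
have [p pU xp] := traceP x; have [q qU yq] := traceP y.
have pF := @ultra_proper _ _ pU; have qF := @ultra_proper _ _ qU.
move=> xy A B V xA yB V1.
have : round (f @ p) [set h | exists2 v, V v & exists2 a, A a & h = v * f a].
  exists V => //; have : p A by apply: round_sub; rewrite -xp.
  by apply: (@filterS _ p) => a Aa v Vv; exists v => //; exists a.
rewrite -(ambit_pushforwardE pU xp) xy (ambit_pushforwardE qU yq).
move=> /round_sub qC.
have qB : q B by apply: round_sub; rewrite -yq.
have [b [[v Vv [a Aa fb]] Bb]] := filter_ex (@filterI _ q _ _ _ qC qB).
exists (b * a^-1), a; rewrite mulgVK; split=> //.
suff -> : f (b * a^-1) = v by [].
by apply: (@mulIg _ (f a)); rewrite -fM mulgVK.
Qed.

Hypothesis fT : range f = [set: H].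

Lemma minimal_image (N : flow G) (Z : flow H) (s : N -> restrict_flow fM fC Z) :
  minimal N -> flow_map s ->
  exists (Y : flow H) (t : N -> restrict_flow fM fC Y),
    [/\ minimal Y, flow_map t, range t = [set: Y] &
      forall p q, t p = t q -> s p = s q].
Proof.
move=> /minimalP [[n0 _] mN] [sc se].
pose C : set Z := range s.
have cC : closed C by exact: (range_closed sc).
have iC (h : H) (z : Z) : C z -> C (act h z).
  have [g _ <-] : range f h by rewrite fT.
  by move=> [n _ <-]; exists (act g n) => //; rewrite se.
pose t (n : N) : subflow cC iC := SigSub (mem_set (imageT s n)).
exists (subflow cC iC), t.
have tT : range t = [set: subflow cC iC].
  apply/seteqP; split=> // y _; have [n _ sn] := set_mem (valP y).
  by exists n => //; exact: val_inj.
split=> //.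
- apply/minimalP; split; first by exists (t n0).
  move=> _ y [W oW <-] [y' Wy'].
  have [n _ ty] : range t y by rewrite tT.
  have [n' _ ty'] : range t y' by rewrite tT.
  have [||g Wg] := mN (s @^-1` W) n.
  + by apply: open_comp => // ? _; exact: sc.
  + by exists n'; move: Wy'; rewrite -ty'.
  by exists (f g); rewrite -ty; move: Wg; rewrite /= se; exact.
- split; first exact: continuous_set_val.
  by move=> g n; apply: val_inj; rewrite /= se.
- by move=> p q /(congr1 val).
Qed.

End ChangeOfGroup.

(** * Transfer of topological transitivity *)

Definition TT_pibase {G : topologicalGroupType} (U : set G) (X : flow G) :=
  forall A : set X, open A -> A !=set0 ->
    exists2 B : set X, B `<=` A & topologically_transitive_for U B.

(** Given A, choose a V-TT set B0 inside t(r^-1(A)), and let B' be the part of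
    r^-1(A) over B0; the interior of r(B') is the required set. Indeed, two
    nonempty open subsets D and E of it come from open subsets of B', whose
    images under t have nonempty interior in B0. As B0 is V-TT, a translate
    g D with f g in V has a point over the same point of Y as some point of E,
    and the last hypothesis moves some point of g D into E. *)
Lemma TT_pibase_transfer (G H : topologicalGroupType) (f : G -> H)
    (fM : {morph f : x y / x * y}) (fC : continuous f)
    (N X : flow G) (Y : flow H) (r : N -> X)
    (t : N -> restrict_flow fM fC Y) (V : set H) (U : set G) :
  range f = [set: H] ->
  minimal N -> flow_map r -> range r = [set: X] ->
  flow_map t -> range t = [set: Y] ->
  TT_pibase V Y -> (forall g h, V (f g) -> V (f h) -> U (g * h)) ->
  (forall p q, t p = t q -> forall D E : set X, open D -> open E ->
     D (r p) -> E (r q) -> exists u x, [/\ V (f u), D x & E (act u x)]) ->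
  TT_pibase U X.
Proof.
move=> fT mN rF rT tF tT ttY VU tnear A oA [a Aa].
have open_r (W : set X) : open W -> open (r @^-1` W).
  by move=> oW; apply: open_comp => // x _; exact: rF.1.
have open_t (W : set Y) : open W -> open (t @^-1` W).
  by move=> oW; apply: open_comp => // x _; exact: tF.1.
have int_t (W : set N) : open W -> W !=set0 -> (t @` W)° !=set0.
  exact: (interior_image_nonempty mN tF tT).
have rA0 : r @^-1` A !=set0.
  have : range r a by rewrite rT.
  by move=> [n _ rn]; exists n; rewrite /= rn.
have [B0 B0A [oB0 [b0 Bb0] B0tt]] :=
  ttY _ (@open_interior _ _) (int_t _ (open_r _ oA) rA0).
pose B' := r @^-1` A `&` t @^-1` B0.
have oB' : open B' by apply: openI; [exact: open_r | exact: open_t].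
have B'0 : B' !=set0.
  have [n An tn] := interior_subset (B0A _ Bb0).
  by exists n; split=> //=; rewrite tn.
have B'sub (W : set N) : (t @` (W `&` B'))° `<=` B0.
  by move=> y /interior_subset [n [_ [_ Bn]] <-].
exists ((r @` B')°); first by move=> x /interior_subset [n [An _] <-].
split; [exact: open_interior | exact: (interior_image_nonempty mN rF rT) | ].
move=> D oD [d Dd] DB x Bx E /= xE.
pose E1 := E° `&` (r @` B')°.
have oE1 : open E1 by apply: openI; exact: open_interior.
have E1x : E1 x by split.
have [n B'n rn] : (r @` B') x by exact: interior_subset.
have [m B'm rm] : (r @` B') d by apply: interior_subset; exact: DB.
have [|y tEy] := int_t (r @^-1` E1 `&` B') (openI (open_r _ oE1) oB').
  by exists n; split=> //=; rewrite rn.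
have [|z tDz] := int_t (r @^-1` D `&` B') (openI (open_r _ oD) oB').
  by exists m; split=> //=; rewrite rm.
have [|||_ [[v Vv [z' tDz' <-]] tEz']] :=
  B0tt (t @` (r @^-1` D `&` B'))° _ _ _ y (B'sub _ _ tEy) _ (nbhs_interior tEy).
- exact: open_interior.
- by exists z.
- exact: B'sub.
have [k [Dk _] tk] := interior_subset tDz'.
have [l [El _] tl] := interior_subset tEz'.
have [g _ fg] : range f v by rewrite fT.
have tgk : t (act g k) = t l by rewrite tF.2 tk tl /= fg.
have [||||u [w [Vu Dw Ew]]] := tnear _ _ tgk (act g^-1 @^-1` D) E1.
- exact: open_act.
- exact: oE1.
- by rewrite /= rF.2 actK.
- exact: El.
exists (act u w); split; last by apply: interior_subset; case: Ew.
exists (u * g); first by apply: VU => //; rewrite fg.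
by exists (act g^-1 w) => //; rewrite actM actVK.
Qed.

(** The transfer lemma for the identity homomorphism, with t the identity of
    M(G) and r the map from M(G) onto the minimal flow. *)
Lemma TMD_minimal (G : topologicalGroupType) (U : set G) (Y : flow G) :
  TMD G -> nbhs (1 : G) U -> minimal Y -> TT_pibase U Y.
Proof.
move=> [M [[mM univM] ttM]] U1 mY; have [r [rF rT]] := univM Y mY.
have [V sV VU] := nbhs1_square U1.
have idM : {morph (id : G -> G) : x y / x * y} by [].
have idC : continuous (id : G -> G) by move=> x; exact: cvg_id.
apply: (@TT_pibase_transfer G G id idM idC M Y M r id V U) => //.
- by apply/seteqP; split=> // g _; exists g.
- by split=> // x; exact: cvg_id.
- by apply/seteqP; split=> // x _; exists x.
- by move=> A; exact: ttM.
- move=> p _ <- D E oD oE Dp Ep; exists 1, (r p); rewrite act1.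
  by split=> //; case: sV.
Qed.

(** The transfer lemma applies with N inside S(G) and Y its image in S(H). As
    [r p] is the limit of [act g x0] along p, an open set around [r p] gives a
    member of the filter p; so the control of the fibers of S(G) -> S(H), which
    speaks of members of filters, becomes the last hypothesis of that lemma. *)
Lemma minimal_TT_pibase (G H : topologicalGroupType) (f : G -> H)
    (U : set G) (V : set H) (X : flow G) :
  {morph f : x y / x * y} -> continuous f -> range f = [set: H] ->
  TMD H -> nbhs (1 : H) V -> (forall g h, V (f g) -> V (f h) -> U (g * h)) ->
  minimal X -> TT_pibase U X.
Proof.
move=> fM fC fT tH V1 VU mX; have [[x0 _] _] := mX.
have [N [i [mN iF]]] :=
  @exists_minimal_flow G ambit_flow (ex_intro _ (ambit_base G) I).
pose s := ambit_pushforward fM fC \o i.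
have sF : flow_map s := flow_map_comp iF (ambit_map_flow_map _).
have [Y [t [mY tF tT ts]]] := minimal_image fT mN sF.
have rF : flow_map (ambit_map x0 \o i) :=
  flow_map_comp iF (ambit_map_flow_map x0).
have rT : range (ambit_map x0 \o i) = [set: X].
  by apply: flow_map_onto => //; case: mN.
apply: (TT_pibase_transfer fT mN rF rT tF tT (TMD_minimal tH V1 mY) VU).
move=> p q /ts spq D E oD oE Dp Eq.
have [||u [a [Vu Da Ea]]] := ambit_pushforward_near spq
  (A := [set g | D (act g x0)]) (B := [set g | E (act g x0)]) _ _ V1.
- by apply: (@ambit_map_cvg _ X x0); exact: open_nbhs_nbhs.
- by apply: (@ambit_map_cvg _ X x0); exact: open_nbhs_nbhs.
by exists u, (act a x0); rewrite -actM.
Qed.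

(** * Inverse limits *)

Section LimitNbhs.
Context d (I : preorderType d) (S : inverse_system I).
Local Notation G := (inverse_limit S).

Lemma limit_proj_continuous i : continuous (limit_proj (S := S) i).
Proof.
move=> x; apply: (@continuous_comp _ _ _ (val : G -> prod_topology (obj S))
  (fun g => g i)); first exact: set_val_continuous.
exact: prod_coord_continuous.
Qed.

(** The preimages of the neighborhoods of 1 in the G_i form a filter base,
    because I is directed, and its filter converges to 1 coordinatewise. *)
Lemma limit_nbhs1 (i0 : I) (U : set G) : directed I -> nbhs (1 : G) U ->
  exists i, exists2 V, nbhs (1 : S i) V & limit_proj i @^-1` V `<=` U.
Proof.
move=> dirI U1.
pose F : set_system G := [set A | exists i, exists2 V, nbhs (1 : S i) V &
  limit_proj i @^-1` V `<=` A].
have FF : Filter F.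
  split.
  - by exists i0, setT => //; exact: filterT.
  - move=> A B [i [V V1 VA]] [j [W W1 WB]]; have [k [ik jk]] := dirI i j.
    have bond1 (a b : I) (ab : (a <= b)%O) : bond (i0 := S) ab 1 = 1.
      by apply: (@mulgI _ (bond ab 1)); rewrite -bondM !mulg1.
    exists k, (bond ik @^-1` V `&` bond jk @^-1` W).
      by apply: filterI; apply: bond_continuous; rewrite bond1.
    move=> g [Vg Wg]; have gc := set_mem (valP g).
    by split; [apply: VA; rewrite /= /limit_proj -(gc i k ik)
             | apply: WB; rewrite /= /limit_proj -(gc j k jk)].
  - move=> A B AB [i [V V1 VA]]; exists i, V => //.
    exact: subset_trans AB.
suff F1 : F --> (1 : G) by exact: F1.
apply: cvg_set_val; apply: cvg_prodP => i V V1.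
by exists i, V.
Qed.

End LimitNbhs.

Theorem proposition6p8 (d : Order.disp_t) (I : preorderType d)
    (S : inverse_system I) :
  directed I -> surjective_system S -> (forall i : I, TMD (S i)) ->
  TMD (inverse_limit S).
Proof.
move=> dirI surjS tmdS.
have [M uM] := exists_universal_minimal_flow (inverse_limit S).
exists M; split=> // U sU; have U1 := symmetric_open_nbhs1_nbhs sU.
have [mM _] := uM; have [[i0]|noI] := pselect (inhabited I); last first.
  (* An empty system has a trivial limit, so U is the whole group, and then
     minimality alone makes every nonempty open set U-TT. *)
  have GU g : U g.
    suff -> : g = 1 by case: sU.
    apply: val_inj; apply: functional_extensionality_dep => i.
    by case: noI; constructor.
  have {}mM := (minimalP M).1 mM; move=> A oA A0; exists A => //; split=> //.
  move=> B oB [b Bb] BA x _ E xE.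
  have [g Eg] := mM.2 E° b (@open_interior _ _) (ex_intro _ x xE).
  exists (act g b); split; last exact: interior_subset.
  by exists g => //; exists b.
have [i [V V1 VU]] := limit_nbhs1 i0 dirI U1.
have [W sW WV] := nbhs1_square V1.
apply: (@minimal_TT_pibase _ (S i) (limit_proj i) U W M) => //.
- exact: limit_proj_continuous.
- by apply/seteqP; split=> // x _; have [g <-] := surjS i x; exists g.
- exact: symmetric_open_nbhs1_nbhs.
- by move=> g h Wg Wh; apply: VU; exact: WV.
Qed.
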